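(* Let $k\ge1$ and let $\alpha_1,\dots,\alpha_{k+1}>0$ be real; put $\beta_j=\alpha_{j+1}+\alpha_{j+2}+\dots+\alpha_k+\alpha_{k+1}$ for $j=1,\dots,k$. Let $(x_1,\dots,x_k)$ have the type-1 Dirichlet density $$f_1(x_1,\dots,x_k)=\frac{\Gamma(\alpha_1+\dots+\alpha_{k+1})}{\Gamma(\alpha_1)\cdots\Gamma(\alpha_{k+1})}x_1^{\alpha_1-1}\cdots x_k^{\alpha_k-1}(1-x_1-\dots-x_k)^{\alpha_{k+1}-1}$$ on $\{0<x_j<1,\ 0<x_1+\dots+x_k<1\}$ and $0$ elsewhere. Let $(v_1,\dots,v_k)$ be a vector of positive real random variables with an arbitrary joint density $f(v_1,\dots,v_k)$ on $(0,\infty)^k$, independent of $(x_1,\dots,x_k)$. Let $y_j=\dfrac{x_j}{1-x_1-\dots-x_{j-1}}$ (with denominator $1$ for $j=1$), let $u_j=v_j/y_j$, $j=1,\dots,k$, and let $g(u_1,\dots,u_k)$ be the joint density of $(u_1,\dots,u_k)$. Then, for (almost every) $(u_1,\dots,u_k)\in(0,\infty)^k$, $$I_{u_j,j=1,\dots,k}^{(\alpha_j,\beta_j),j=1,\dots,k}f(u_1,\dots,u_k)=\Big\{\prod_{j=1}^k\frac{\Gamma(\alpha_j)}{\Gamma(\alpha_j+\beta_j)}\Big\}g(u_1,\dots,u_k).$$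
   Context: The multivariable Kober fractional integral operator of the first kind is defined, for parameters $\zeta_j$ and $\alpha_j>0$, by $$I_{u_j,j=1,\dots,k}^{(\zeta_j,\alpha_j),j=1,\dots,k}f(u_1,\dots,u_k)=\Big\{\prod_{j=1}^k\frac{u_j^{-\zeta_j-\alpha_j}}{\Gamma(\alpha_j)}\Big\}\int_{0}^{u_1}\cdots\int_{0}^{u_k}\Big\{\prod_{j=1}^k(u_j-v_j)^{\alpha_j-1}v_j^{\zeta_j}\Big\}f(v_1,\dots,v_k)\,dv_1\cdots dv_k;$$ here it is applied with $\zeta_j=\alpha_j$ and $\alpha_j$ replaced by $\beta_j$. *)

(* Defs.v *)
From HB Require Import structures.
From mathcomp Require Import all_boot all_order all_algebra.
From mathcomp Require Import all_classical all_reals all_analysis.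
Set Implicit Arguments. Unset Strict Implicit. Unset Printing Implicit Defensive.
Import Order.TTheory GRing.Theory Num.Theory.
Import numFieldNormedType.Exports.
Local Open Scope classical_set_scope.
Local Open Scope ring_scope.

Section Defs.
Variable R : realType.

Definition Gamma (a : R) : R :=
  fine (\int[@lebesgue_measure R]_(t in `]0%R, +oo[) ((t `^ (a - 1)) * expR (- t))%:E)%E.

Fixpoint iint (n : nat) (G : seq R -> \bar R) : \bar R :=
  match n with
  | 0 => G [::]
  | n'.+1 => (\int[@lebesgue_measure R]_x iint n' (fun s => G (x :: s)))%E
  end.

(* Lebesgue integral over R^k (as iterated integral, = product-measure integral
   for nonnegative measurable integrands by Tonelli) of F : k.-tuple R -> \bar R. *)
Definition mint (k : nat) (F : k.-tuple R -> \bar R) : \bar R :=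
  iint k (fun s => F [tuple nth 0 s i | i < k]).

Definition leb_null (k : nat) (N : set (k.-tuple R)) : Prop :=
  exists M : set (k.-tuple R), [/\ measurable M, N `<=` M &
    mint (fun t => (\1_M t)%:E) = 0%E].

Definition has_density d (Omega : measurableType d) (P : probability Omega R)
  (k : nat) (X : Omega -> k.-tuple R) (f : k.-tuple R -> R) : Prop :=
  forall A : set (k.-tuple R), measurable A ->
    P (X @^-1` A) = mint (fun t => (\1_A t * f t)%:E).

Definition indep_vec d (Omega : measurableType d) (P : probability Omega R)
  (k : nat) (X Y : Omega -> k.-tuple R) : Prop :=
  forall A B : set (k.-tuple R), measurable A -> measurable B ->
    P (X @^-1` A `&` Y @^-1` B) = (P (X @^-1` A) * P (Y @^-1` B))%E.

(* Parameters are 0-indexed: alpha 0, ..., alpha k stand for alpha_1..alpha_{k+1}. *)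
(* beta j (0-indexed) = alpha (j+1) + ... + alpha k  (paper's beta_{j+1}). *)
Definition dbeta (k : nat) (alpha : nat -> R) (j : nat) : R :=
  \sum_(j.+1 <= i < k.+1) alpha i.

Definition dirichlet1 (k : nat) (alpha : nat -> R) (x : k.-tuple R) : R :=
  if [forall j : 'I_k, (0 < tnth x j < 1)] &&
     (0 < \sum_(j < k) tnth x j < 1)
  then Gamma (\sum_(i < k.+1) alpha i) / (\prod_(i < k.+1) Gamma (alpha i)) *
       (\prod_(j < k) (tnth x j `^ (alpha j - 1))) *
       ((1 - \sum_(j < k) tnth x j) `^ (alpha k - 1))
  else 0.

Definition ytrans (k : nat) (x : k.-tuple R) : k.-tuple R :=
  [tuple tnth x j / (1 - \sum_(i < k | (i < j)%N) tnth x i) | j < k].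

Definition kober1 (k : nat) (zeta a : nat -> R) (f : k.-tuple R -> R)
  (u : k.-tuple R) : \bar R :=
  ((\prod_(j < k) (tnth u j `^ (- zeta j - a j) / Gamma (a j)))%:E *
   mint (fun v : k.-tuple R =>
     ((\1_[set w : k.-tuple R | forall j, 0 < tnth w j < tnth u j] v) *
      (\prod_(j < k) ((tnth u j - tnth v j) `^ (a j - 1) * tnth v j `^ zeta j)) *
      f v)%:E))%E.

End Defs.
Arguments dirichlet1 {R} k alpha x.

(* Main.v *)
(** Write [u = v / y], where [y] is the stick-breaking transform of the Dirichlet
    vector [x]. Since [x] and [v] are independent, the joint law of [(x, v)] has
    the product density, so the law of [u] on a measurable set [A] is an integral
    over [v] of an integral over [x]. For a fixed positive [v] the map [x -> u] is
    triangular: once [x_1, ..., x_(j-1)] are chosen, [x_j] is a constant divided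
    by [u_j], and the remaining coordinates again carry an unnormalised Dirichlet
    density, on a smaller simplex. Changing one variable at a time turns the
    Dirichlet density into a product of beta kernels in [v_j / u_j]; after
    Tonelli's theorem the density of [u] is, up to the Gamma factors, the Kober
    integral of [f]. The constants agree because [alpha_j + beta_j = beta_(j-1)],
    so that the Gamma quotients telescope and no beta integral is needed. *)
Require Import Defs.
From HB Require Import structures.
From mathcomp Require Import all_boot all_order all_algebra.
From mathcomp Require Import all_classical all_reals all_analysis.
From mathcomp Require Import measurable_realfun simple_functions.
From mathcomp Require Import measurable_fun_approximation ring lra.
Set Implicit Arguments.
Unset Strict Implicit.
Unset Printing Implicit Defensive.
Import Order.TTheory GRing.Theory Num.Theory.
Import numFieldNormedType.Exports.
Local Open Scope classical_set_scope.
Local Open Scope ring_scope.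

(** * Measures with a density and image measures *)

Section density_measure.
Local Open Scope ereal_scope.
Context d (T : measurableType d) (R : realType) (m : {measure set T -> \bar R}).
Variable g : T -> R.
Hypothesis mg : measurable_fun setT g.
Hypothesis g0 : forall x, (0 <= g x)%R.

Definition density_of (A : set T) : \bar R := \int[m]_(x in A) (g x)%:E.

Let density_of0 : density_of set0 = 0.
Proof. exact: integral_set0. Qed.

Let density_of_ge0 A : 0 <= density_of A.
Proof. by apply: integral_ge0 => x _; rewrite lee_fin. Qed.

Let density_of_sigma_additive : semi_sigma_additive density_of.
Proof.
move=> F mF tF mUF; rewrite /density_of ge0_integral_bigcup//; last 2 first.
- by apply: measurable_funTS; exact/measurable_EFinP.
- by move=> x _; rewrite lee_fin.
apply: is_cvg_ereal_nneg_natsum_cond => n _ _.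
by apply: integral_ge0 => x _; rewrite lee_fin.
Qed.

(** Packed as a genuine measure so that uniqueness theorems apply to it: that of Lebesgue measure
    for the substitution [x = K / u], and that of product measures for the joint law. *)
Definition density_measure : {measure set T -> \bar R} :=
  HB.pack_for {measure set T -> \bar R} density_of
    (isMeasure.Build _ _ _ density_of density_of0 density_of_ge0
      density_of_sigma_additive).

Lemma density_measureE A : density_measure A = \int[m]_(x in A) (g x)%:E.
Proof. by []. Qed.

Import HBNNSimple.

(** Simple functions increase to [F], monotone convergence handles both sides, and on an indicator
    the claim is the definition of the density measure. *)
Lemma ge0_integral_density_measure (F : T -> \bar R) :
  measurable_fun setT F -> (forall x, 0 <= F x) ->
  \int[density_measure]_x F x = \int[m]_x (F x * (g x)%:E).
Proof.
move=> mF F0; pose f_ := nnsfun_approx measurableT mF.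
have f_ge0 n x : 0 <= (f_ n x)%:E by rewrite lee_fin.
have nd_f x : {homo (fun n => (f_ n x)%:E) : a b / (a <= b)%N >-> a <= b}.
  by move=> a b ab; rewrite lee_fin; exact/lefP/nd_nnsfun_approx.
have cvgf x : (f_ n x)%:E @[n --> \oo] --> F x.
  by apply: cvg_nnsfun_approx.
transitivity (limn (fun n => \int[density_measure]_x (f_ n x)%:E)).
  rewrite -monotone_convergence//.
  - by apply: eq_integral => x _; apply/esym/cvg_lim => //.
  - by move=> n; exact/measurable_EFinP/measurable_funP.
transitivity (limn (fun n => \int[m]_x ((f_ n x)%:E * (g x)%:E))); last first.
  rewrite -monotone_convergence//.
  - apply: eq_integral => x _; apply/cvg_lim => //.
    by apply: cvgeZr => //; exact: cvgf.
  - by move=> n; apply: emeasurable_funM => //; exact/measurable_EFinP.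
  - by move=> n x _; rewrite mule_ge0 ?lee_fin//.
  - by move=> x _ a b ab; rewrite lee_wpmul2r ?lee_fin//; exact: nd_f.
congr (limn _); apply/funext => n.
transitivity (\sum_(k \in range (f_ n))
    \int[density_measure]_x (k * \1_(f_ n @^-1` [set k]) x)%:E).
  under eq_integral do rewrite fimfunE -fsumEFin//.
  rewrite ge0_integral_fsum//.
  - by move=> y; exact/measurable_EFinP/measurable_funM.
  - by move=> y x _; rewrite nnfun_muleindic_ge0.
transitivity (\sum_(k \in range (f_ n))
    \int[m]_x ((k * \1_(f_ n @^-1` [set k]) x)%:E * (g x)%:E)).
  apply: eq_fsbigr => r /[!inE] -[y _ <-].
  rewrite integralZl_indic_nnsfun// integral_indic//= setIT.
  under [RHS]eq_integral do rewrite EFinM -muleA.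
  rewrite ge0_integralZl//.
  - congr *%E; rewrite /density_measure/= /density_of integral_mkcond.
    apply: eq_integral => x _; rewrite patchE indicE.
    by case: ifPn => _; rewrite ?mul1e ?mul0e.
  - by apply: emeasurable_funM => //; exact/measurable_EFinP.
  - by move=> x _; rewrite mule_ge0 ?lee_fin.
rewrite -ge0_integral_fsum//.
- apply: eq_integral => x _; rewrite [in RHS](fimfunE (f_ n)) -fsumEFin//.
  rewrite ge0_mule_fsuml// => k; exact: nnfun_muleindic_ge0.
- move=> r; apply: emeasurable_funM => //.
  exact/measurable_EFinP/measurable_funM.
  exact/measurable_EFinP.
- move=> r x _; apply: mule_ge0; last by rewrite lee_fin.
  by rewrite EFinM; exact: nnfun_muleindic_ge0.
Qed.

End density_measure.

Section image_measure.
Context d d' (T : measurableType d) (T' : measurableType d') (R : realType).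
Variables (m : {measure set T -> \bar R}) (f : T -> T').
Hypothesis mf : measurable_fun setT f.

Definition image_measure : {measure set T' -> \bar R} :=
  measure_function_pushforward__canonical__measure_function_Measure m mf.

Lemma image_measureE A : image_measure A = m (f @^-1` A).
Proof. by []. Qed.

Lemma ge0_integral_image_measure D (F : T' -> \bar R) : measurable D ->
  measurable_fun D F -> (forall y, 0 <= F y)%E ->
  (\int[image_measure]_(y in D) F y = \int[m]_(x in f @^-1` D) F (f x))%E.
Proof. by move=> mD mF F0; apply: (ge0_integral_pushforward mf). Qed.

End image_measure.

(** * The change of variables x = K / u *)

Section inversion.
Context (R : realType).
Implicit Types (K a b : R).
Notation mu := (@lebesgue_measure R).

(* The identity [x^-1 = x * (x^2)^-1], valid also at [0] since [0^-1 = 0], reduces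
   the claim to the measurability of powers of nonnegative numbers. *)
Lemma measurable_invr : measurable_fun [set: R] (fun x : R => x^-1).
Proof.
rewrite (_ : (fun _ => _) = fun x => x * (x ^+ 2) `^ (-1)).
  apply: measurable_funM => //; apply: (measurableT_comp (measurable_powR _)) => //.
apply/funext => x; rewrite powR_inv1 ?sqr_ge0//.
have [->|x0] := eqVneq x 0; first by rewrite invr0 mul0r.
by field.
Qed.

(** The absolute Jacobian of [u -> K / u] for [K > 0], cut off to the positive half-line. *)
Definition inv_jac K (u : R) : R := \1_`]0, +oo[%classic u * (K / u ^+ 2).

Let inv_pos K (u : R) : 0 < K -> (0 < K / u) = (0 < u).
Proof. by move=> K0; rewrite pmulr_rgt0// invr_gt0. Qed.

Let measurable_div K : measurable_fun [set: R] (fun u : R => K / u).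
Proof. by apply: measurable_funM => //; exact: measurable_invr. Qed.

Let measurable_inv_jac K : measurable_fun [set: R] (inv_jac K).
Proof.
apply: measurable_funM => //; apply: measurable_funM => //.
by apply: (measurableT_comp measurable_invr) => //; exact: measurable_funX.
Qed.

Let inv_jac_ge0 K (u : R) : 0 < K -> 0 <= inv_jac K u.
Proof.
by move=> K0; rewrite mulr_ge0// divr_ge0 ?sqr_ge0// ltW.
Qed.

(** The antiderivative [- K / u] vanishes at infinity. The value is the mass that the Jacobian
    density gives to the points [u > 0] with [K / u <= b]. *)
Lemma integral_div_sqr K b : 0 < K -> 0 < b ->
  (\int[mu]_(u in `[(K / b)%R, +oo[) (K / u ^+ 2)%:E = b%:E)%E.
Proof.
move=> K0 b0; have Kb0 : 0 < K / b by rewrite divr_gt0.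
have F1 (x : R) : K / b <= x -> is_derive x 1 (fun u : R => - K / u) (K / x ^+ 2).
  move=> Kbx; have x0 : x != 0 by rewrite gt_eqF// (lt_le_trans Kb0).
  have dV := is_deriveZ (- K) (is_deriveV x0 (is_derive_id x (1 : R^o))).
  by apply: (is_derive_eq dV); rewrite /GRing.scale/=; field.
transitivity (0%:E - (- K / (K / b))%:E)%E; last first.
  by rewrite sub0e -EFinN; congr EFin; field; rewrite !gt_eqF.
apply: (@ge0_continuous_FTC2y R (fun u => K / u ^+ 2) (fun u => - K / u)).
- by move=> x _; rewrite divr_ge0 ?sqr_ge0// ltW.
- apply: continuous_in_subspaceT => x; rewrite inE/= in_itv/= andbT => Kbx.
  have x0 : x != 0 by rewrite gt_eqF// (lt_le_trans Kb0).
  apply: cvgM; first exact: cvg_cst.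
  apply: cvgV; first by rewrite sqrf_eq0.
  exact: exprn_continuous.
- rewrite -[X in _ --> X](mulr0 (- K)).
  by apply: cvgM; [exact: cvg_cst|]; apply/gtr0_cvgV0 => //; exact: nbhs_pinfty_gt.
- by move=> x /ltW/F1[].
- apply: cvg_at_right_filter.
  apply: cvgM; first exact: cvg_cst.
  by apply: cvgV; [rewrite gt_eqF|exact: cvg_id].
- move=> x; rewrite in_itv/= andbT => /ltW/F1 h.
  by rewrite derive1E; exact: derive_val.
Qed.

Let nu K (K0 : 0 < K) :=
  density_measure mu (measurable_inv_jac K) (fun u => inv_jac_ge0 u K0).

Let nuE K (K0 : 0 < K) A : nu K0 A = (\int[mu]_(u in A) (inv_jac K u)%:E)%E.
Proof. by []. Qed.

(** For [b > 0] and [u > 0] the condition reads [K / b <= u]; points [u <= 0] carry no mass, hence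
    the truncation of [b] at [0]. *)
Let nu_le K (K0 : 0 < K) b :
  nu K0 [set u | K / u <= b] = (Num.max b 0)%:E.
Proof.
rewrite nuE; have [b0|b0] := ltP 0 b.
  rewrite -(integral_div_sqr K0 b0) integral_mkcond [RHS]integral_mkcond.
  apply: eq_integral => u _; rewrite !patchE.
  rewrite (_ : (u \in [set v | K / v <= b]) = (K / u <= b)); last first.
    by apply/idP/idP; rewrite in_setE.
  rewrite /inv_jac indicE !mem_setE/= !in_itv/= !andbT.
  have [u0|u0] := ltP 0 u; first by rewrite mul1r !ler_pdivrMr// mulrC.
  rewrite mul0r [in RHS]ifF; first by case: ifP.
  by apply/negbTE; rewrite -ltNge (le_lt_trans u0)// divr_gt0.
apply: integral0_eq => u /= Kub; rewrite /inv_jac indicE mem_setE/= in_itv/= andbT.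
rewrite ltNge; have [u0|u0] := leP u 0; first by rewrite mul0r.
by move: b0; rewrite leNgt (lt_le_trans _ Kub)// divr_gt0.
Qed.

Let nu_oc K (K0 : 0 < K) a b : a <= b ->
  nu K0 [set u | a < K / u <= b] = (Num.max b 0 - Num.max a 0)%:E.
Proof.
move=> ab; have mS (c : R) : measurable [set u : R | K / u <= c].
  rewrite [X in measurable X](_ : _ = (fun u : R => K / u) @^-1` `]-oo, c]).
    by rewrite -[X in measurable X]setTI; exact: measurable_div.
  by apply/seteqP; split => u/=; rewrite in_itv.
have -> : [set u | a < K / u <= b] = [set u | K / u <= b] `\` [set u | K / u <= a].
  apply/seteqP; split => u/=.
    by move=> /andP[aK ->]; split => //; apply/negP; rewrite -ltNge.
  by move=> [-> /negP]; rewrite -ltNge => ->.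
have -> : (Num.max b 0 - Num.max a 0)%:E =
    (nu K0 [set u | (K / u <= b)%R] -
     nu K0 ([set u | (K / u <= b)%R] `&` [set u | (K / u <= a)%R]))%E.
  rewrite (_ : _ `&` _ = [set u | K / u <= a]) ?nu_le//.
  by apply/seteqP; split => u/= => [[]//|ua]; split => //; exact: le_trans ab.
apply: measureD; [exact: mS|exact: mS|].
by move: (nu_le K0 b) => /= ->; rewrite ltry.
Qed.

Let phi K := (fun u : R => K / u) : measurableTypeR R -> measurableTypeR R.

Let mphi K : measurable_fun setT (phi K).
Proof. exact: measurable_div. Qed.

Let m0 : measurable (`]-oo, 0] : set (measurableTypeR R)).
Proof. exact: measurable_itv. Qed.

(* The inverted measure only lives on the positive half-line, so Lebesgue measure
   on the negative one is added to get a measure determined by its values on the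
   intervals [`]a, b]]. *)
Let mu_pushforward K (K0 : 0 < K) (A : set (measurableTypeR R)) :
  measurable A ->
  mu A = measure_add (image_measure (nu K0) (mphi K)) (mrestr mu m0) A.
Proof.
move=> mA; apply: lebesgue_measure_unique => // _ [[a b] _] <-.
rewrite [(a, b).1]/= [(a, b).2]/=.
have [ab|ba] := leP a b; last by rewrite set_itv_ge ?measure0// bnd_simp -leNgt ltW.
rewrite [RHS]measure_addE image_measureE.
rewrite (_ : phi K @^-1` _ = [set u | a < K / u <= b]); last first.
  by apply/seteqP; split => u; rewrite /= /phi in_itv.
rewrite nu_oc//.
(* The point [0] cuts []a, b]]: the image measure sees the positive piece, this summand the piece up
   to [0]. *)
rewrite [X in (_ + X)%E](_ : _ = mu `]a, Num.min b 0]%classic); last first.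
  congr (mu _); apply/seteqP; split => u; rewrite /= !in_itv/= le_min.
    by move=> [/andP[-> ->] ->].
  by move=> /and3P[-> -> ->].
rewrite !lebesgue_measure_itv/= !lte_fin /Num.max /Num.min.
by case: (ltP b 0) => b0; case: (ltP a b) => ab'; case: (ltP a 0) => a0;
  rewrite -?EFinB -?EFinD; congr EFin; lra.
Qed.

Lemma ge0_integral_inversion K (F : R -> \bar R) : 0 < K ->
  measurable_fun setT F -> (forall x, 0 <= F x)%E ->
  (\int[mu]_(x in `]0%R, +oo[) F x =
   \int[mu]_(u in `]0%R, +oo[) (F (K / u)%R * (K / u ^+ 2)%:E))%E.
Proof.
move=> K0 mF F0.
transitivity (\int[image_measure (nu K0) (mphi K)]_(x in `]0%R, +oo[) F x)%E.
  apply: eq_measure_integral => A mA A0.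
  apply: (eq_trans (mu_pushforward K0 mA)); rewrite [LHS]measure_addE.
  (* The Lebesgue measure added on []-oo, 0]] gives no mass to subsets of the positive half-line. *)
  rewrite -[RHS]adde0; congr (_ + _)%E.
  rewrite -[RHS](measure0 mu); congr (mu _).
  apply/seteqP; split => // u [/A0/=].
  by rewrite !in_itv/= andbT => /lt_le_trans/[apply]; rewrite ltxx.
rewrite ge0_integral_image_measure//; last exact: measurable_funTS.
rewrite (_ : _ @^-1` _ = `]0, +oo[%classic); last first.
  by apply/seteqP; split => u; rewrite /= /phi !in_itv/= !andbT inv_pos.
rewrite integral_mkcond ge0_integral_density_measure; last 2 first.
- apply/(measurable_restrictT _ _).1 => //; apply: measurable_funTS.
  exact: measurableT_comp.
- by move=> x; rewrite erestrict_ge0// => ? _.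
rewrite [RHS]integral_mkcond; apply: eq_integral => u _.
rewrite !patchE /inv_jac indicE.
by case: ifPn => _; rewrite ?mul1r ?mul0e.
Qed.

End inversion.

(** * Lebesgue measure on tuples *)

Lemma sigma_finite_product d1 d2 (T1 : measurableType d1)
  (T2 : measurableType d2) (R : realType)
  (m1 : {sigma_finite_measure set T1 -> \bar R})
  (m2 : {sigma_finite_measure set T2 -> \bar R}) :
  sigma_finite setT (m1 \x m2)%E.
Proof.
have [F UF mF] := sigma_finiteT m1; have [G UG mG] := sigma_finiteT m2.
(* Pairs of indices are enumerated by [pickle]; the default [(0, 0)] only repeats a rectangle. *)
pose ij (k : nat) := odflt (0, 0)%N (unpickle k : option (nat * nat)).
exists (fun k => F (ij k).1 `*` G (ij k).2).
  apply/esym; rewrite -subTset => -[x y] _.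
  have [i _ Fi] : (\bigcup_i F i) x by rewrite -UF.
  have [j _ Gj] : (\bigcup_j G j) y by rewrite -UG.
  by exists (pickle (i, j)) => //; rewrite /ij pickleK.
move=> k; have [mFk Fk] := mF (ij k).1; have [mGk Gk] := mG (ij k).2.
split; first exact: measurableX.
by rewrite product_measure1E// lte_mul_pinfty// ge0_fin_numE.
Qed.

Section tuple_lebesgue.
Context (R : realType).
Notation mu := (@lebesgue_measure R).

Lemma mint_cons n (F : n.+1.-tuple R -> \bar R) :
  mint F = (\int[mu]_x mint (fun t => F [tuple of x :: t]))%E.
Proof.
rewrite /mint/=; apply: eq_integral => x _; congr (iint _ _).
apply/funext => s; congr F; apply: eq_from_tnth => i; rewrite tnth_mktuple.
have [->|[j ->]] : i = ord0 \/ exists j, i = lift ord0 j.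
  by case: (unliftP ord0 i) => [j ->|->]; [right; exists j|left].
  by [].
by rewrite tnthS/= tnth_mktuple.
Qed.

Lemma mint_nil (F : 0.-tuple R -> \bar R) : mint F = F [tuple].
Proof. by rewrite /mint/=; congr F; exact: tuple0. Qed.

Let cons_pair n (z : measurableTypeR R * n.-tuple R) : n.+1.-tuple R :=
  [tuple of z.1 :: z.2].

Let mcons_pair n : measurable_fun setT (@cons_pair n).
Proof. exact: measurable_cons. Qed.

Let cons_sigma_finite n (L : {sigma_finite_measure set (n.-tuple R) -> \bar R}) :
  sigma_finite setT (image_measure (mu \x L)%E (@mcons_pair n)).
Proof.
have [F UF mF] := sigma_finite_product mu L.
(* Consing is a bijection with inverse head and tail, so the exhausting sets are transported along
   that inverse. *)
pose S k := [set t : n.+1.-tuple R | F k (thead t, [tuple of behead t])].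
exists S.
  apply/esym; rewrite -subTset => t _.
  have : [set: measurableTypeR R * n.-tuple R] (thead t, [tuple of behead t]) by [].
  by rewrite UF => -[k _ Fk]; exists k.
move=> k; have [mFk Fk] := mF k; split.
  have mh : measurable_fun setT
      (fun t : n.+1.-tuple R => (thead t : measurableTypeR R, [tuple of behead t])).
    apply: measurable_fun_pair; last exact: measurable_behead.
    exact: measurable_tnth.
  by rewrite -[S k]setTI; exact: mh.
rewrite image_measureE (_ : _ @^-1` _ = F k)//.
have bK (x : R) (t : n.-tuple R) : [tuple of behead [tuple of x :: t]] = t.
  exact: val_inj.
by apply/seteqP; split => -[x t]; rewrite /S/cons_pair/= theadE bK.
Qed.

(** Turns the iterated integral into one against a sigma-finite measure, so that Tonelli's theorem
    and almost-everywhere comparison become available. Each dimension adds a Lebesgue factor,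
    carried to tuples by consing. *)
Lemma tuple_lebesgue n :
  exists L : {sigma_finite_measure set (n.-tuple R) -> \bar R},
  forall F, measurable_fun setT F -> (forall t, 0 <= F t)%E ->
  mint F = (\int[L]_t F t)%E.
Proof.
elim: n => [|n [L LE]].
  exists (dirac ([tuple] : 0.-tuple R)) => F mF F0.
  by rewrite mint_nil integral_dirac// diracT mul1e.
pose L' := HB.pack_for {sigma_finite_measure set (n.+1.-tuple R) -> \bar R}
  (Measure.sort (image_measure (mu \x L)%E (@mcons_pair n)))
  (Measure_isSigmaFinite.Build _ _ _ _ (cons_sigma_finite L)).
exists L' => F mF F0.
transitivity (\int[image_measure (mu \x L)%E (@mcons_pair n)]_t F t)%E => //.
rewrite ge0_integral_image_measure// fubini_tonelli1//=; last first.
  exact: (measurableT_comp mF (@mcons_pair n)).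
rewrite mint_cons; apply: eq_integral => x _.
rewrite LE// /fubini_F//; apply: (measurableT_comp mF).
exact: measurable_cons.
Qed.

End tuple_lebesgue.

(** * Measurability of finite sums, products, quotients and powers *)

Section measurability.
Context d (T : measurableType d) (R : realType).

Lemma measurable_fun_bigprod n (f : 'I_n -> T -> R) :
  (forall j, measurable_fun setT (f j)) ->
  measurable_fun setT (fun x => \prod_(j < n) f j x).
Proof.
elim: n f => [|n IH] f mf.
  under eq_fun do rewrite big_ord0.
  exact: measurable_cst.
under eq_fun do rewrite big_ord_recl.
by apply: measurable_funM => //; exact: IH.
Qed.

Lemma measurable_fun_bigsum n (P : pred 'I_n) (f : 'I_n -> T -> R) :
  (forall j, measurable_fun setT (f j)) ->
  measurable_fun setT (fun x => \sum_(j < n | P j) f j x).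
Proof.
by move=> mf; under eq_fun do rewrite -big_filter; exact: measurable_sum.
Qed.

Lemma measurable_fun_divr (f g : T -> R) : measurable_fun setT f ->
  measurable_fun setT g -> measurable_fun setT (fun x => f x / g x).
Proof.
move=> mf mg; apply: measurable_funM => //.
exact: (measurableT_comp (@measurable_invr R)).
Qed.

Lemma measurable_fun_natb (b : T -> bool) : measurable_fun setT b ->
  measurable_fun setT (fun x => (b x)%:R : R).
Proof.
move=> mb; rewrite (_ : (fun _ => _) = fun x => if b x then 1 else 0).
  exact: measurable_fun_ifT.
by apply/funext => x; case: (b x).
Qed.

Lemma measurable_fun_powr (f : T -> R) a : measurable_fun setT f ->
  measurable_fun setT (fun x => f x `^ a).
Proof. by move=> mf; exact: (measurableT_comp (measurable_powR a)). Qed.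

Lemma measurable_fun_tnth n (f : T -> n.-tuple R) j :
  measurable_fun setT f -> measurable_fun setT (fun x => tnth (f x) j).
Proof. by move=> mf; exact: (measurableT_comp (measurable_tnth j)). Qed.

End measurability.

(** * Basic rules for the integral over tuples *)

Section mint_theory.
Context (R : realType) (n : nat).
Implicit Types F : n.-tuple R -> \bar R.

Lemma ge0_mintZl (c : R) F : 0 <= c -> measurable_fun setT F ->
  (forall t, 0 <= F t)%E -> mint (fun t => c%:E * F t)%E = (c%:E * mint F)%E.
Proof.
move=> c0 mF F0; have [L LE] := tuple_lebesgue R n.
rewrite !LE ?ge0_integralZl//; first exact: measurable_funeM.
by move=> t; rewrite mule_ge0// lee_fin.
Qed.

Lemma measurable_mint d (T : measurableType d) (F : T -> n.-tuple R -> \bar R) :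
  measurable_fun setT (fun z => F z.1 z.2) -> (forall x t, 0 <= F x t)%E ->
  measurable_fun setT (fun x => mint (F x)).
Proof.
move=> mF F0; have [L LE] := tuple_lebesgue R n.
rewrite (_ : (fun _ => _) = fubini_F L (fun z => F z.1 z.2)).
  by apply: measurable_fun_fubini_tonelli_F.
apply/funext => x; rewrite LE//.
exact: (measurable_fun_pair2 x mF).
Qed.

Lemma mint_ge0 F : (forall t, 0 <= F t)%E -> (0 <= mint F)%E.
Proof.
rewrite /mint; set G := fun s => F _; move=> F0.
have : forall s, (0 <= G s)%E by move=> s; exact: F0.
elim: n G => [|k IH] G G0 //=.
by apply: integral_ge0 => x _; exact: IH.
Qed.

End mint_theory.

(** * From the Dirichlet density to beta kernels *)

Section dirichlet_change.
Context (R : realType).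
Implicit Types (alpha : nat -> R) (r : R).

(* Unnormalised Dirichlet density on the simplex of size [r]; the size varies
   because fixing [x_1] leaves a simplex of size [r - x_1]. *)
Definition dirichlet_kernel n alpha r (x : n.-tuple R) : R :=
  (\prod_(j < n) ((0 < tnth x j)%R%:R * tnth x j `^ (alpha j - 1))) *
  ((\sum_(j < n) tnth x j < r)%R%:R *
   (r - \sum_(j < n) tnth x j) `^ (alpha n - 1)).

(** At [r = 1] this is [u = v / y] for the stick-breaking transform [y] of [x]; other values of [r]
    arise once a first piece has been broken off. *)
Definition stick_ratio n r (v x : n.-tuple R) : n.-tuple R :=
  [tuple tnth v j / (tnth x j / (r - \sum_(i < n | (i < j)%N) tnth x i))
    | j < n].

(* Unnormalised density at [u] of [v / y], for [y] of beta type [(a, b)]. *)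
Definition beta_ratio (a b u v : R) : R :=
  (0 < v < u)%R%:R * ((v / u) `^ (a - 1) * (1 - v / u) `^ (b - 1) * (v / u ^+ 2)).

Definition beta_kernel n alpha (u v : n.-tuple R) : R :=
  \prod_(j < n) beta_ratio (alpha j) (dbeta n alpha j) (tnth u j) (tnth v j).

Let shift alpha i := alpha i.+1.

Let dirichlet_kernel_cons n alpha r x (t : n.-tuple R) :
  dirichlet_kernel alpha r [tuple of x :: t] =
  (0 < x)%R%:R * x `^ (alpha 0 - 1) * dirichlet_kernel (shift alpha) (r - x) t.
Proof.
rewrite /dirichlet_kernel !big_ord_recl/= -!mulrA.
under eq_bigr do rewrite tnthS.
under [in X in (X < r)%R%:R]eq_bigr do rewrite tnthS.
under [in X in r - X]eq_bigr do rewrite tnthS.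
by rewrite ltrBrDl opprD addrA.
Qed.

Let stick_ratio_cons n r v x (vs t : n.-tuple R) :
  stick_ratio r [tuple of v :: vs] [tuple of x :: t] =
  [tuple of v / (x / r) :: stick_ratio (r - x) vs t].
Proof.
apply: eq_from_tnth => j; rewrite tnth_mktuple.
case: (unliftP ord0 j) => [i ->|->].
  rewrite !tnthS tnth_mktuple; congr (_ / (_ / _)).
  rewrite big_mkcond big_ord_recl/= opprD addrA; congr (_ - _).
  by rewrite [RHS]big_mkcond; apply: eq_bigr => k _; rewrite tnthS.
by rewrite big1 ?subr0.
Qed.

Let beta_kernel_cons n alpha u v (us vs : n.-tuple R) :
  beta_kernel alpha [tuple of u :: us] [tuple of v :: vs] =
  beta_ratio (alpha 0) (\sum_(0 <= i < n.+1) shift alpha i) u v *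
  beta_kernel (shift alpha) us vs.
Proof.
rewrite /beta_kernel big_ord_recl /dbeta big_add1/=; congr (_ * _).
by apply: eq_bigr => j _; rewrite !tnthS big_add1.
Qed.

Lemma measurable_dirichlet_kernel n alpha r :
  measurable_fun setT (@dirichlet_kernel n alpha r).
Proof.
have mt j : measurable_fun setT (fun x : n.-tuple R => tnth x j).
  exact: measurable_tnth.
have ms : measurable_fun setT (fun x : n.-tuple R => \sum_(j < n) tnth x j).
  exact: measurable_fun_bigsum.
apply: measurable_funM.
  apply: measurable_fun_bigprod => j; apply: measurable_funM.
    by apply: measurable_fun_natb; exact: measurable_fun_ltr.
  exact: measurable_fun_powr.
apply: measurable_funM.
  by apply: measurable_fun_natb; exact: measurable_fun_ltr.
by apply: measurable_fun_powr; exact: measurable_funB.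
Qed.

Lemma measurable_stick_ratio n r :
  measurable_fun setT (fun z : n.-tuple R * n.-tuple R => stick_ratio r z.1 z.2).
Proof.
apply/measurable_fun_tnthP => j.
rewrite (_ : _ \o _ = fun z : n.-tuple R * n.-tuple R => tnth z.1 j /
    (tnth z.2 j / (r - \sum_(i < n | (i < j)%N) tnth z.2 i))); last first.
  by apply/funext => z /=; rewrite tnth_mktuple.
apply: measurable_fun_divr; first exact: measurable_fun_tnth.
apply: measurable_fun_divr; first exact: measurable_fun_tnth.
apply: measurable_funB => //.
by apply: measurable_fun_bigsum => i; exact: measurable_fun_tnth.
Qed.

Lemma measurable_beta_ratio d (T : measurableType d) (a b : R) (f g : T -> R) :
  measurable_fun setT f -> measurable_fun setT g ->
  measurable_fun setT (fun z => beta_ratio a b (f z) (g z)).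
Proof.
move=> mf mg; apply: measurable_funM.
  by apply: measurable_fun_natb; apply: measurable_and; exact: measurable_fun_ltr.
apply: measurable_funM; first apply: measurable_funM.
- by apply: measurable_fun_powr; exact: measurable_fun_divr.
- by apply: measurable_fun_powr; apply: measurable_funB => //; exact: measurable_fun_divr.
- by apply: measurable_fun_divr => //; exact: measurable_funX.
Qed.

Lemma measurable_beta_kernel n alpha :
  measurable_fun setT (fun z : n.-tuple R * n.-tuple R => beta_kernel alpha z.1 z.2).
Proof.
by apply: measurable_fun_bigprod => j; apply: measurable_beta_ratio;
  exact: measurable_fun_tnth.
Qed.

Lemma dirichlet_kernel_ge0 n alpha r (x : n.-tuple R) :
  0 <= dirichlet_kernel alpha r x.
Proof.
rewrite mulr_ge0// ?mulr_ge0// ?powR_ge0// prodr_ge0// => j _.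
by rewrite mulr_ge0// powR_ge0.
Qed.

Lemma beta_ratio_ge0 a b u v : 0 <= beta_ratio a b u v.
Proof.
rewrite /beta_ratio; have [/andP[v0 vu]|] := boolP (0 < v < u); last by rewrite mul0r.
by rewrite mul1r !mulr_ge0 ?powR_ge0 ?invr_ge0 ?sqr_ge0// ltW.
Qed.

Lemma beta_kernel_ge0 n alpha (u v : n.-tuple R) : 0 <= beta_kernel alpha u v.
Proof. by apply: prodr_ge0 => j _; exact: beta_ratio_ge0. Qed.

(** Under [x = r v / u] one has [r - x = r (1 - v / u)], so the exponents of [r] add up: [a - 1]
    from [x], [b - 1] from [r - x], and [1] from the Jacobian [r v / u^2]. *)
Lemma beta_ratio_subst r a b u v : 0 < r -> 0 < v -> 0 < u ->
  ((r * v / u) `^ (a - 1) * ((0 < r - r * v / u)%R%:R *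
   (r - r * v / u) `^ (b - 1))) * (r * v / u ^+ 2) =
  r `^ (a + b - 1) * beta_ratio a b u v.
Proof.
move=> r0 v0 u0; have vu0 : 0 < v / u by rewrite divr_gt0.
rewrite (_ : r - r * v / u = r * (1 - v / u)); last by ring.
rewrite pmulr_rgt0// subr_gt0 ltr_pdivrMr// mul1r /beta_ratio v0/=.
have [vu|] := boolP (v < u); last by rewrite !(mul0r, mulr0).
have vu1 : 0 <= 1 - v / u by rewrite subr_ge0 ler_pdivrMr// mul1r ltW.
have -> : r * v / u = r * (v / u) by rewrite mulrA.
rewrite (powRM _ (ltW r0) (ltW vu0)) (powRM _ (ltW r0) vu1).
rewrite (_ : a + b - 1 = (a - 1) + (b - 1) + 1); last by ring.
rewrite (@powRD _ r (a - 1 + (b - 1))) ?(gt_eqF r0) ?implybT//.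
rewrite (@powRD _ r (a - 1)) ?(gt_eqF r0) ?implybT// powRr1 ?(ltW r0)//.
by rewrite !mul1r; field; rewrite gt_eqF.
Qed.

Let G_cons n (G : n.+1.-tuple R -> \bar R) (u : R) : measurable_fun setT G ->
  measurable_fun setT (fun t : n.-tuple R => G [tuple of u :: t]).
Proof. by move=> mG; apply: (measurableT_comp mG); exact: measurable_cons. Qed.

(* In [r] the integral is homogeneous of degree [sum alpha - 1]; in the induction
   step, with [r - x_1] for [r], this power becomes the factor
   [(1 - v_1 / u_1)^(beta_1 - 1)] of the first beta kernel. *)
Lemma mint_dirichlet_kernel n alpha r (v : n.-tuple R) (G : n.-tuple R -> \bar R) :
  (forall j, 0 < tnth v j) -> measurable_fun setT G -> (forall t, 0 <= G t)%E ->
  (mint (fun x => (dirichlet_kernel alpha r x)%:E * G (stick_ratio r v x)) =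
   ((0 < r)%R%:R * r `^ (\sum_(0 <= i < n.+1) alpha i - 1))%:E *
   mint (fun u => (beta_kernel alpha u v)%:E * G u))%E.
Proof.
elim: n alpha r v G => [|n IH] alpha r v G v0 mG G0.
  rewrite !mint_nil /dirichlet_kernel /beta_kernel !big_ord0 !mul1r subr0.
  by rewrite big_nat1 mul1e tuple0.
have [v1 [vs vE]] : exists (v1 : R) (vs : n.-tuple R), v = [tuple of v1 :: vs].
  by exists (thead v), [tuple of behead v]; exact: tuple_eta.
have v10 : 0 < v1 by have := v0 ord0; rewrite vE.
have vs0 j : 0 < tnth vs j by have := v0 (lift ord0 j); rewrite vE tnthS.
rewrite {v v0}vE.
(* What the induction hypothesis leaves of the inner integral, apart from a power of [r - x]: a
   function of the first coordinate of [u] alone. *)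
pose Phi u := mint (fun us => (beta_kernel (shift alpha) us vs)%:E *
                              G [tuple of u :: us])%E.
have Phi0 u : (0 <= Phi u)%E.
  by apply: mint_ge0 => t; rewrite mule_ge0// lee_fin beta_kernel_ge0.
have mk : measurable_fun setT (fun us : n.-tuple R => beta_kernel (shift alpha) us vs).
  exact: (measurable_fun_pair1 vs (measurable_beta_kernel (shift alpha))).
have mPhi : measurable_fun setT Phi.
  apply: measurable_mint; last first.
    by move=> u t; rewrite mule_ge0// lee_fin beta_kernel_ge0.
  apply: emeasurable_funM.
    by apply/measurable_EFinP; exact: (measurableT_comp mk).
  by apply: (measurableT_comp mG); exact: measurable_cons.
set b := \sum_(0 <= i < n.+1) shift alpha i.
have bE : \sum_(0 <= i < n.+2) alpha i = alpha 0 + b by rewrite big_nat_recl.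
rewrite !mint_cons bE.
transitivity (\int[@lebesgue_measure R]_(x in `]0%R, +oo[)
    ((x `^ (alpha 0 - 1) * ((0 < r - x)%R%:R * (r - x) `^ (b - 1)))%:E *
     Phi (v1 / (x / r))%R))%E.
  rewrite [RHS]integral_mkcond; apply: eq_integral => x _.
  rewrite patchE mem_setE in_itv/= andbT.
  under eq_fun do rewrite dirichlet_kernel_cons stick_ratio_cons EFinM -muleA.
  rewrite ge0_mintZl; last 3 first.
  - by rewrite mulr_ge0// powR_ge0.
  - apply: emeasurable_funM.
      by apply/measurable_EFinP; exact: measurable_dirichlet_kernel.
    apply: (measurableT_comp mG); apply: measurable_cons => //.
    exact: (measurable_fun_pair2 vs (measurable_stick_ratio _)).
  - by move=> t; rewrite mule_ge0// lee_fin dirichlet_kernel_ge0.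
  rewrite (IH _ _ _ (fun t => G [tuple of v1 / (x / r) :: t]))//; last exact: G_cons.
  rewrite -/b -/(Phi _).
  have [x0|x0] := ltP 0 x; last by rewrite mul0r mul0e.
  by rewrite mul1r subr_gt0 muleA -EFinM.
(* For [r <= 0] every [x > 0] exceeds [r], so both sides vanish. *)
have [r0|r0] := ltP 0 r; last first.
  rewrite mul0r mul0e integral0_eq// => x/=; rewrite in_itv/= andbT => x0.
  by rewrite subr_gt0 ltNge (le_trans r0 (ltW x0))/= mul0r mulr0 mul0e.
(* The substitution [x = r v1 / u] makes [v1 / (x / r)] equal to [u]. *)
rewrite (ge0_integral_inversion (mulr_gt0 r0 v10)); last 2 first.
- apply: emeasurable_funM.
    apply/measurable_EFinP; apply: measurable_funM; first exact: measurable_fun_powr.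
    apply: measurable_funM.
      by apply: measurable_fun_natb; apply: measurable_fun_ltr => //; exact: measurable_funB.
    by apply: measurable_fun_powr; exact: measurable_funB.
  apply: (measurableT_comp mPhi); apply: measurable_fun_divr => //.
  exact: measurable_fun_divr.
- by move=> x; rewrite mule_ge0// lee_fin !mulr_ge0// powR_ge0.
have psiE u : mint (fun t => (beta_kernel alpha [tuple of u :: t] [tuple of v1 :: vs])%:E *
    G [tuple of u :: t])%E = ((beta_ratio (alpha 0) b u v1)%:E * Phi u)%E.
  under eq_fun do rewrite beta_kernel_cons EFinM -muleA.
  rewrite ge0_mintZl ?beta_ratio_ge0//.
    apply: emeasurable_funM; last exact: G_cons.
    exact/measurable_EFinP.
  by move=> t; rewrite mule_ge0// lee_fin beta_kernel_ge0.
under [in RHS]eq_integral do rewrite psiE.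
rewrite mul1r -ge0_integralZl//; last 3 first.
- apply: emeasurable_funM => //; apply/measurable_EFinP.
  exact: measurable_beta_ratio.
- by move=> u _; rewrite mule_ge0// lee_fin beta_ratio_ge0.
- by rewrite lee_fin powR_ge0.
rewrite [LHS]integral_mkcond; apply: eq_integral => u _.
rewrite patchE mem_setE in_itv/= andbT.
(* The right-hand integral runs over all [u], but [beta_ratio] vanishes for [u <= 0] because
   [v1 > 0]. *)
have [u0|u0] := ltP 0 u; last first.
  rewrite (_ : beta_ratio _ _ _ _ = 0) ?mul0e ?mule0//.
  rewrite /beta_ratio (_ : (0 < v1 < u) = false) ?mul0r//.
  by rewrite [v1 < u]ltNge (le_trans u0 (ltW v10)) andbF.
have -> : v1 / (r * v1 / u / r) = u by field; rewrite !gt_eqF.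
move: (Phi u) => p.
rewrite [RHS]muleA -[X in _ = (X * _)%E]EFinM.
rewrite -(beta_ratio_subst _ _ r0 v10 u0).
rewrite [LHS]muleAC.
by rewrite EFinM.
Qed.

End dirichlet_change.

(** * Telescoping of the Gamma factors *)

Section Gamma_telescope.
Context (R : realType).
Notation mu := (@lebesgue_measure R).

Let Gamma_integrand (a t : R) : R := t `^ (a - 1) * expR (- t).

Let measurable_Gamma_integrand a : measurable_fun setT (Gamma_integrand a).
Proof.
apply: measurable_funM; first exact: measurable_fun_powr.
by apply: (measurableT_comp (@measurable_expR R)); exact: measurable_funN.
Qed.

Let Gamma_integrand_ge0 a t : 0 <= Gamma_integrand a t.
Proof. by rewrite mulr_ge0 ?powR_ge0 ?expR_ge0. Qed.

Let Gamma_int a := (\int[mu]_(t in `]0%R, +oo[) (Gamma_integrand a t)%:E)%E.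

Let Gamma_int_ge0 a : (0 <= Gamma_int a)%E.
Proof. by apply: integral_ge0 => t _; rewrite lee_fin. Qed.

(** A nonnegative integrand with zero integral vanishes off a null set. This one is positive on the
    whole half-line, so the null set would contain []0, 1[], of measure [1]. *)
Let Gamma_int_neq0 a : Gamma_int a != 0%E.
Proof.
apply/eqP => G0.
have mD : measurable (`]0%R, +oo[%classic : set (measurableTypeR R)) by [].
have mf : measurable_fun (`]0%R, +oo[%classic : set (measurableTypeR R))
    (fun t => (Gamma_integrand a t)%:E).
  by apply: measurable_funTS; apply/measurable_EFinP; exact: measurable_Gamma_integrand.
have := (ae_eq_integral_abs mu mD mf).1.
rewrite (_ : (\int[_]_(_ in _) _)%E = 0%E); last first.
  by rewrite -G0; apply: eq_integral => t _; rewrite gee0_abs// lee_fin.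
move=> /(_ erefl)[N [mN N0 NS]].
have : (mu `]0%R, 1%R[%classic <= mu N)%E.
  apply: le_measure; rewrite ?inE// => t/=; rewrite in_itv/= => /andP[t0 _].
  apply: NS => /= h; have : t \in `]0%R, +oo[ by rewrite in_itv/= t0.
  by move=> /h/= []/eqP; rewrite gt_eqF// mulr_gt0 ?powR_gt0 ?expR_gt0.
by rewrite N0 lebesgue_measure_itv/= lte_fin ltr01 oppr0 adde0 lee_fin ler10.
Qed.

Lemma Gamma_ge0 (a : R) : 0 <= Gamma a.
Proof. by apply: fine_ge0; exact: Gamma_int_ge0. Qed.

(* [Gamma] is defined through [fine], so [Gamma a != 0] in particular says that the
   integral is finite; here [t^(b-1) <= t^(a-1) + t^(c-1)] bounds the one in the
   middle. *)
Lemma Gamma_neq0_between (a b c : R) : a <= b <= c ->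
  Gamma a != 0 -> Gamma c != 0 -> Gamma b != 0.
Proof.
move=> /andP[ab bc].
have fin_num_Gamma e : Gamma e != 0 -> Gamma_int e \is a fin_num.
  by move=> G0; apply: contra_neqT G0; rewrite /Gamma -/(Gamma_int e) fin_numE
    => /nandP[]/negPn/eqP ->.
move=> /fin_num_Gamma Ga /fin_num_Gamma Gc.
have mG e : measurable_fun (`]0%R, +oo[%classic : set (measurableTypeR R))
    (fun t => (Gamma_integrand e t)%:E).
  by apply: measurable_funTS; apply/measurable_EFinP; exact: measurable_Gamma_integrand.
have Gb : Gamma_int b \is a fin_num.
  rewrite ge0_fin_numE//; apply: (@le_lt_trans _ _ (Gamma_int a + Gamma_int c)%E).
    rewrite -ge0_integralD//; last 2 first.
    - by move=> t _; rewrite lee_fin.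
    - by move=> t _; rewrite lee_fin.
    apply: ge0_le_integral => //.
    - by move=> t _; rewrite lee_fin.
    - by apply: emeasurable_funD; exact: mG.
    move=> t /=; rewrite in_itv/= andbT => t0.
    rewrite -EFinD lee_fin -mulrDl ler_wpM2r ?expR_ge0//.
    have [t1|t1] := leP t 1.
      rewrite -[leLHS]addr0 lerD ?powR_ge0// ger_powR ?t0//.
      by rewrite lerD2r.
    rewrite -[leLHS]add0r lerD ?powR_ge0// ler_powR ?(ltW t1)//.
    by rewrite lerD2r.
  by rewrite lte_add_pinfty// -ge0_fin_numE.
by rewrite /Gamma -/(Gamma_int b) fine_eq0.
Qed.

(* The assumption that the constant does not vanish is what total mass [1] of the
   Dirichlet density provides. *)
Lemma Gamma_telescope k (alpha : nat -> R) :
  (forall i, (i <= k)%N -> 0 < alpha i) ->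
  Gamma (\sum_(i < k.+1) alpha i) / (\prod_(i < k.+1) Gamma (alpha i)) != 0 ->
  \prod_(j < k) (Gamma (dbeta k alpha j))^-1 =
  (\prod_(j < k) (Gamma (alpha j) / Gamma (alpha j + dbeta k alpha j))) *
  (Gamma (\sum_(i < k.+1) alpha i) / (\prod_(i < k.+1) Gamma (alpha i))).
Proof.
move=> alpha0; rewrite mulf_eq0 negb_or invr_eq0 => /andP[GS0 /prodf_neq0 Gal].
(* Here [S j = alpha j + dbeta k alpha j] and [S j.+1 = dbeta k alpha j], so the products involve
   [Gamma] at consecutive tail sums. *)
pose S j := \sum_(j <= i < k.+1) alpha i.
have SS j : (j < k.+1)%N -> alpha j + dbeta k alpha j = S j.
  by move=> jk; rewrite /S big_ltn.
have S0 : \sum_(i < k.+1) alpha i = S 0 by rewrite /S big_mkord.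
have Sk : S k = alpha k by rewrite /S big_nat1.
have Sge i : (i <= k)%N -> alpha k <= S i <= S 0.
  move=> ik; rewrite /S (big_cat_nat (n := i) (m := 0))//=; last exact: leqW.
  rewrite (big_cat_nat (n := k) (m := i))//= big_nat1.
  have nn m p : (p <= k)%N -> 0 <= \sum_(m <= i < p) alpha i.
    move=> pk; rewrite big_nat_cond sumr_ge0// => l /andP[/andP[_ lp] _].
    by rewrite ltW// alpha0// (leq_trans (ltnW lp)).
  by rewrite !lerDr !nn.
(* Every tail sum lies between [S k = alpha k] and [S 0], where [Gamma] is nonzero because the
   normalising constant is. *)
have GS i : (i <= k)%N -> Gamma (S i) != 0.
  move=> ik; apply: (Gamma_neq0_between (Sge i ik)); last by rewrite -S0.
  exact: (Gal ord_max).
have tele m : (m <= k)%N ->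
    \prod_(j < m) (Gamma (S j) / Gamma (S j.+1)) = Gamma (S 0) / Gamma (S m).
  elim: m => [|m IH] mk; first by rewrite big_ord0 divff// GS.
  rewrite big_ord_recr/= IH ?(ltnW mk)// mulrA divfK// GS//; exact: ltnW.
have := tele k (leqnn k); rewrite big_split/= prodfV.
set C := \prod_(j < k) Gamma (S j); set B := \prod_(j < k) Gamma (S j.+1).
have B0 : B != 0 by apply/prodf_neq0 => j _; exact: GS.
have A0 : \prod_(j < k) Gamma (alpha j) != 0.
  by apply/prodf_neq0 => j _; exact: (Gal (widen_ord (leqnSn k) j)).
have C0 : C != 0 by apply/prodf_neq0 => j _; exact/GS/ltnW.
move=> /(canRL (mulfVK B0)) CE.
rewrite big_split/= prodfV S0 [in RHS]big_ord_recr/= -Sk.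
have -> : \prod_(j < k) Gamma (alpha j + dbeta k alpha j) = C.
  by apply: eq_bigr => j _; rewrite SS // ltnS ltnW.
have {}GS0 : Gamma (S 0) != 0 by rewrite -S0.
have GSk : Gamma (S k) != 0 by exact: GS.
move: C0; rewrite CE => C0; field.
by rewrite B0 A0 GS0 GSk.
Qed.

End Gamma_telescope.

(** * The Kober integral and the law of u *)

Section dirichlet1_kernel.
Context (R : realType) (k : nat) (alpha : nat -> R).

Definition dirichlet_cst : R :=
  Gamma (\sum_(i < k.+1) alpha i) / (\prod_(i < k.+1) Gamma (alpha i)).

Lemma dirichlet_cst_ge0 : 0 <= dirichlet_cst.
Proof. by rewrite divr_ge0 ?Gamma_ge0// prodr_ge0// => i _; exact: Gamma_ge0. Qed.

(** The two supports agree: positive coordinates with sum below [1] are each below [1], and their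
    sum is positive since [k >= 1]. *)
Lemma dirichlet1E (x : k.-tuple R) : (1 <= k)%N ->
  dirichlet1 k alpha x = dirichlet_cst * dirichlet_kernel alpha 1 x.
Proof.
move=> k1; rewrite /dirichlet1 /dirichlet_kernel -/dirichlet_cst.
case: ifPn => [/andP[/forallP x01 /andP[_ ->]]|].
  rewrite mul1r -mulrA; congr (_ * (_ * _)).
  by apply: eq_bigr => j _; have /andP[-> _] := x01 j; rewrite mul1r.
have [/forallP x0|/forallPn[j xj0] _] := boolP [forall j, 0 < tnth x j]; last first.
  by rewrite (bigD1 j)//= (negbTE xj0) !mul0r mulr0.
have [x1|x1 _] := boolP (\sum_(j < k) tnth x j < 1); last first.
  by rewrite mul0r !mulr0.
move=> /negP[]; rewrite andbT; apply/andP; split; last first.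
  rewrite (bigD1 (Ordinal k1))//= ltr_wpDr// sumr_ge0// => j _; exact: ltW.
apply/forallP => j; rewrite x0/=; apply: le_lt_trans x1.
by rewrite (bigD1 j)//= lerDl sumr_ge0// => i _; exact: ltW.
Qed.

End dirichlet1_kernel.

Lemma indic_forall_prod (R : realType) k (u v : k.-tuple R) :
  \1_[set w : k.-tuple R | forall j, 0 < tnth w j < tnth u j] v =
  \prod_(j < k) (0 < tnth v j < tnth u j)%R%:R :> R.
Proof.
rewrite indicE; have [vu|] := boolP (v \in _).
  by rewrite big1// => j _; move: vu; rewrite inE/= => ->.
rewrite notin_setE/= => /existsNP[j /negP vj].
by rewrite (bigD1 j)//= (negbTE vj) mul0r.
Qed.

(** In each coordinate, with [a = alpha j] and [b = dbeta k alpha j], on [0 < v < u] the factor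
    [(u - v)^(b - 1) v^a] is [u^(a + b)] times the beta kernel; this power of [u] cancels the
    prefactor [u^(- a - b)]. *)
Lemma kober1E (R : realType) k (alpha : nat -> R) (f : k.-tuple R -> R)
  (u : k.-tuple R) : (forall j, 0 < tnth u j) ->
  measurable_fun setT f -> (forall t, 0 <= f t) ->
  kober1 alpha (dbeta k alpha) f u =
  ((\prod_(j < k) (Gamma (dbeta k alpha j))^-1)%:E *
   mint (fun v => (f v * beta_kernel alpha u v)%:E))%E.
Proof.
move=> u0 mf f0; rewrite /kober1.
pose c := \prod_(j < k) (tnth u j `^ (alpha j + dbeta k alpha j)).
have mfk : measurable_fun setT (fun v => (f v * beta_kernel alpha u v)%:E).
  apply/measurable_EFinP; apply: measurable_funM => //.
  exact: (measurable_fun_pair2 u (measurable_beta_kernel alpha)).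
have -> : (fun v : k.-tuple R =>
     ((\1_[set w : k.-tuple R | forall j, 0 < tnth w j < tnth u j] v) *
      (\prod_(j < k) ((tnth u j - tnth v j) `^ (dbeta k alpha j - 1) *
          tnth v j `^ alpha j)) * f v)%:E) =
    (fun v => c%:E * (f v * beta_kernel alpha u v)%:E)%E.
  apply/funext => v; rewrite -EFinM; congr EFin.
  rewrite [f v * _]mulrC mulrA; congr (_ * _).
  rewrite indic_forall_prod /c /beta_kernel -!big_split/=; apply: eq_bigr => j _.
  set a := alpha j; set b := dbeta k alpha j; rewrite /beta_ratio.
  have [/andP[v0 vu]|_] := boolP (_ < _ < _); last by rewrite !mul0r mulr0.
  have {}u0 := u0 j; rewrite !mul1r.
  set s := tnth u j in u0 vu *; set t := tnth v j in v0 vu *.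
  have s0 : 0 <= s := ltW u0; have t0 : 0 <= t := ltW v0.
  have st0 : 0 <= s - t by rewrite subr_ge0 ltW.
  have -> : 1 - t / s = (s - t) / s by field; rewrite gt_eqF.
  rewrite !powRM ?invr_ge0//.
  have powV e : s^-1 `^ e = (s `^ e)^-1.
    by rewrite -powR_inv1// -powRrM mulN1r powRN.
  (* Exponents are split into [a - 1], [b - 1] and [1], so that [field] sees the same nonzero powers
     on both sides. *)
  have -> : a + b = (a - 1) + (b - 1) + 1 + 1 by ring.
  rewrite [X in _ * t `^ X = _](_ : a = (a - 1) + 1); last by ring.
  rewrite (@powRD _ t) ?(gt_eqF v0) ?implybT// (@powRD _ s (_ + _ + 1))
    ?(gt_eqF u0) ?implybT// (@powRD _ s (_ + _)) ?(gt_eqF u0) ?implybT//.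
  rewrite (@powRD _ s (a - 1)) ?(gt_eqF u0) ?implybT// !powV !powRr1//.
  have p1 : s `^ (a - 1) != 0 by rewrite gt_eqF// powR_gt0.
  have p2 : s `^ (b - 1) != 0 by rewrite gt_eqF// powR_gt0.
  have p3 : s != 0 by rewrite gt_eqF.
  by field; rewrite p1 p2 p3.
rewrite ge0_mintZl//; last 2 first.
- by apply: prodr_ge0 => j _; exact: powR_ge0.
- by move=> v; rewrite lee_fin mulr_ge0// beta_kernel_ge0.
rewrite muleA -EFinM; congr (_%:E * _)%E.
rewrite /c -big_split/=; apply: eq_bigr => j _.
rewrite -opprD powRN mulrAC mulVf ?mul1r//.
by rewrite gt_eqF// powR_gt0.
Qed.

(** On rectangles the law of [(x, v)] is a product by independence, and the measure with density
    [p z.1 * f z.2] is one by Tonelli; uniqueness of product measures identifies both with the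
    product of the marginal laws. *)
Lemma joint_law_density d (Omega : measurableType d) (R : realType)
  (P : probability Omega R) k
  (x v : {RV P >-> k.-tuple R}) (p f : k.-tuple R -> R)
  (L : {sigma_finite_measure set (k.-tuple R) -> \bar R})
  (C : set (k.-tuple R * k.-tuple R)) :
  measurable_fun setT p -> (forall t, 0 <= p t) ->
  measurable_fun setT f -> (forall t, 0 <= f t) ->
  (forall A, measurable A -> P (x @^-1` A) = (\int[L]_t (\1_A t * p t)%:E)%E) ->
  (forall A, measurable A -> P (v @^-1` A) = (\int[L]_t (\1_A t * f t)%:E)%E) ->
  indep_vec P x v -> measurable C ->
  P [set w | C (x w, v w)] =
  (\int[L \x L]_z (\1_C z * (p z.1 * f z.2))%:E)%E.
Proof.
move=> mp p0 mf f0 Px Pv ind mC.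
have mxv : measurable_fun setT (fun w => (x w, v w)).
  by apply: measurable_fun_pair; exact: measurable_funPT.
have mpf : measurable_fun setT (fun z : k.-tuple R * k.-tuple R => p z.1 * f z.2).
  by apply: measurable_funM; exact: measurableT_comp.
have pf0 (z : k.-tuple R * k.-tuple R) : 0 <= p z.1 * f z.2 by rewrite mulr_ge0.
have m1 (A : set (k.-tuple R)) (h : k.-tuple R -> R) : measurable A ->
    measurable_fun setT h -> measurable_fun setT (fun t => (\1_A t * h t)%:E).
  by move=> mA mh; apply/measurable_EFinP; exact: measurable_funM.
have h1 (A : set (k.-tuple R)) (h : k.-tuple R -> R) : (forall t, 0 <= h t) ->
    forall t, (0 <= (\1_A t * h t)%:E)%E.
  by move=> h0 t; rewrite lee_fin mulr_ge0.
pose J := image_measure P mxv.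
pose J' := density_measure (L \x L)%E mpf pf0.
transitivity ((distribution P x \x distribution P v)%E C).
  by apply/esym; apply: (@product_measure_unique _ _ _ _ _ _ _ J).
transitivity (J' C).
  apply: (@product_measure_unique _ _ _ _ _ _ _ J') => // A B mA mB.
  rewrite /J' density_measureE integral_mkcond.
  transitivity (\int[L \x L]_z ((\1_A z.1 * p z.1)%:E * (\1_B z.2 * f z.2)%:E))%E.
    apply: eq_integral => z _; rewrite patchE in_setX !indicE -EFinM.
    by case: (z.1 \in A); case: (z.2 \in B); rewrite /= ?(mul1r, mul0r, mulr0).
  rewrite fubini_tonelli1/=; last 2 first.
  - apply: emeasurable_funM.
      exact: (measurableT_comp (m1 _ _ mA mp) measurable_fst).
    exact: (measurableT_comp (m1 _ _ mB mf) measurable_snd).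
  - by move=> z; rewrite mule_ge0// h1.
  rewrite /distribution /pushforward Px// Pv//.
  rewrite -ge0_integralZr//; [|exact: m1|by move=> t _; exact: h1|
    by apply: integral_ge0 => t _; exact: h1].
  apply: eq_integral => t _; rewrite /fubini_F/= ge0_integralZl//; first exact: m1.
  - by move=> y _; exact: h1.
  - exact: h1.
rewrite /J' density_measureE integral_mkcond; apply: eq_integral => z _.
by rewrite patchE indicE; case: ifPn; rewrite ?mul1r ?mul0r.
Qed.

Theorem theorem2p4 (R : realType) (d : measure_display) (Omega : measurableType d)
  (P : probability Omega R) (k : nat) (alpha : nat -> R)
  (x v : {RV P >-> k.-tuple R}) (f g : k.-tuple R -> R) :
  (1 <= k)%N ->
  (forall i, (i <= k)%N -> 0 < alpha i) ->
  has_density P x (dirichlet1 k alpha) ->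
  measurable_fun setT f -> (forall t, 0 <= f t) ->
  (forall t, ~ (forall j, 0 < tnth t j) -> f t = 0) ->
  has_density P v f ->
  indep_vec P x v ->
  measurable_fun setT g -> (forall t, 0 <= g t) ->
  has_density P
    (fun w => [tuple tnth (v w) j / tnth (ytrans (x w)) j | j < k]) g ->
  leb_null [set u : k.-tuple R | (forall j, 0 < tnth u j) /\
    kober1 alpha (dbeta k alpha) f u <>
    ((\prod_(j < k) (Gamma (alpha j) / Gamma (alpha j + dbeta k alpha j))) * g u)%:E].
Proof.
move=> k1 alpha0 Dx mf f0 fpos Dv ind mg g0 Du.
have [L LE] := tuple_lebesgue R k.
have mind (A : set (k.-tuple R)) : measurable A -> measurable_fun setT (\1_A : _ -> R).
  by move=> mA; exact: measurable_indic.
have densE (h : k.-tuple R -> R) (A : set (k.-tuple R)) :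
    measurable_fun setT h -> (forall t, 0 <= h t) -> measurable A ->
    mint (fun t => (\1_A t * h t)%:E) = (\int[L]_t (\1_A t * h t)%:E)%E.
  move=> mh h0 mA; apply: LE; last by move=> t; rewrite lee_fin mulr_ge0.
  by apply/measurable_EFinP; apply: measurable_funM => //; exact: mind.
pose cD := dirichlet_cst k alpha.
have cD0 : 0 <= cD by exact: dirichlet_cst_ge0.
pose p (t : k.-tuple R) := cD * dirichlet_kernel alpha 1 t.
have pE : dirichlet1 k alpha = p by apply/funext => t; exact: dirichlet1E.
have mp : measurable_fun setT p.
  by apply: measurable_funM => //; exact: measurable_dirichlet_kernel.
have p0 t : 0 <= p t by rewrite mulr_ge0 ?dirichlet_kernel_ge0.
rewrite pE in Dx.
have Px A : measurable A -> P (x @^-1` A) = (\int[L]_t (\1_A t * p t)%:E)%E.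
  by move=> mA; rewrite Dx ?densE.
have Pv A : measurable A -> P (v @^-1` A) = (\int[L]_t (\1_A t * f t)%:E)%E.
  by move=> mA; rewrite Dv ?densE.
(* With a zero constant, for instance if [fine] had sent an infinite Gamma integral to [0], the law
   of [x] would have mass [0] instead of [1]. *)
have cD_neq0 : cD != 0.
  apply/eqP => c0; have := Px setT measurableT.
  rewrite preimage_setT probability_setT integral0_eq; last first.
    by move=> t _; rewrite /p c0 mul0r mulr0.
  by move/eqP; rewrite onee_eq0.
(* The density that the change of variables predicts for [u], a priori allowed to take the value
   [+oo]. *)
pose h (u : k.-tuple R) := (\int[L]_v (cD * (f v * beta_kernel alpha u v))%:E)%E.
have m_cfk : measurable_fun setT (fun z : k.-tuple R * k.-tuple R =>
    (cD * (f z.2 * beta_kernel alpha z.1 z.2))%:E).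
  apply/measurable_EFinP; apply: measurable_funM => //; apply: measurable_funM.
    exact: measurableT_comp.
  exact: measurable_beta_kernel.
have cfk0 u t : (0 <= (cD * (f t * beta_kernel alpha u t))%:E)%E.
  by rewrite lee_fin mulr_ge0// mulr_ge0// beta_kernel_ge0.
have mh : measurable_fun setT h.
  rewrite (_ : h = fubini_F L (fun z : k.-tuple R * k.-tuple R =>
    (cD * (f z.2 * beta_kernel alpha z.1 z.2))%:E))//.
  by apply: measurable_fun_fubini_tonelli_F => // z; exact: cfk0.
(* Both sides are the probability that [u] lies in [A]: the left by the hypothesis on [g], the right
   by computing with the product density. *)
have key A : measurable A -> (\int[L]_(u in A) (g u)%:E = \int[L]_(u in A) h u)%E.
  move=> mA; have mA1 := mind A mA.
  have mAsr : measurable_fun setT (fun z : k.-tuple R * k.-tuple R =>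
      \1_A (stick_ratio 1 z.2 z.1) : R).
    apply: (measurableT_comp mA1).
    exact: (measurableT_comp (measurable_stick_ratio 1) (@measurable_swap _ _ _ _)).
  transitivity (\int[L]_t (\1_A t * g t)%:E)%E.
    rewrite integral_mkcond; apply: eq_integral => t _.
    by rewrite patchE indicE; case: ifPn; rewrite ?mul1r ?mul0r.
  rewrite -densE// -Du//.
  pose C := [set z : k.-tuple R * k.-tuple R | A (stick_ratio 1 z.2 z.1)].
  have mC : measurable C.
    rewrite -[C]setTI.
    exact: (measurableT_comp (measurable_stick_ratio 1) (@measurable_swap _ _ _ _)).
  rewrite (_ : _ @^-1` A = [set w | C (x w, v w)]); last first.
    apply/funext => w; rewrite /C/preimage/=; congr (A _).
    by apply: eq_from_tnth => j; rewrite !tnth_mktuple.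
  rewrite (joint_law_density mp p0 mf f0 Px Pv ind mC).
  have mCpf : measurable_fun setT (fun z : k.-tuple R * k.-tuple R =>
      (\1_C z * (p z.1 * f z.2))%:E).
    apply/measurable_EFinP; apply: measurable_funM; first exact: measurable_indic.
    by apply: measurable_funM; exact: measurableT_comp.
  (* The order with [x] innermost keeps [v] fixed while the variables are changed. *)
  rewrite (fubini_tonelli2 _ mCpf); last first.
    by move=> z; rewrite lee_fin mulr_ge0// mulr_ge0.
  have mAcfk : measurable_fun setT (fun z : k.-tuple R * k.-tuple R =>
      (\1_A z.1)%:E * (cD * (f z.2 * beta_kernel alpha z.1 z.2))%:E)%E.
    apply: emeasurable_funM => //; apply/measurable_EFinP.
    exact: measurableT_comp.
  have Acfk0 z : (0 <= (\1_A z.1)%:E * (cD * (f z.2 * beta_kernel alpha z.1 z.2))%:E)%E.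
    by rewrite mule_ge0// lee_fin.
  transitivity (\int[L]_t \int[L]_u
      ((\1_A u)%:E * (cD * (f t * beta_kernel alpha u t))%:E))%E.
    apply: eq_integral => t _; rewrite /fubini_G/=.
    (* The change of variables needs all coordinates of [v] positive; elsewhere [f] vanishes. *)
    have [/forallP t0|/forallPn[j tj]] := boolP [forall j, 0 < tnth t j]; last first.
      have ft0 : f t = 0 by apply: fpos => /(_ j); exact/negP.
      by rewrite !integral0_eq// => y _; rewrite ft0 !(mul0r, mulr0, mule0).
    have mtA : measurable_fun setT (fun y => (\1_A (stick_ratio 1 t y))%:E : \bar R).
      apply/measurable_EFinP.
      exact: (measurable_fun_pair1 t mAsr).
    have mD : measurable_fun setT (fun y : k.-tuple R => (dirichlet_kernel alpha 1 y)%:E).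
      by apply/measurable_EFinP; exact: measurable_dirichlet_kernel.
    have mK : measurable_fun setT (fun u => (beta_kernel alpha u t)%:E).
      apply/measurable_EFinP.
      exact: (measurable_fun_pair1 t (measurable_beta_kernel alpha)).
    have cf0 : 0 <= cD * f t by rewrite mulr_ge0.
    transitivity ((cD * f t)%:E * mint (fun y =>
        (dirichlet_kernel alpha 1 y)%:E * (\1_A (stick_ratio 1 t y))%:E))%E.
      rewrite LE; [|exact: emeasurable_funM|]; last first.
        by move=> y; rewrite mule_ge0 ?lee_fin ?dirichlet_kernel_ge0.
      rewrite -ge0_integralZl//; [|exact: emeasurable_funM|]; last first.
        by move=> y _; rewrite mule_ge0 ?lee_fin ?dirichlet_kernel_ge0.
      apply: eq_integral => y _; rewrite -!EFinM; congr EFin.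
      by rewrite /p (_ : \1_C (y, t) = \1_A (stick_ratio 1 t y)) ?indicE//; ring.
    have mAE : measurable_fun setT (fun u => (\1_A u)%:E : \bar R).
      exact/measurable_EFinP.
    have AE0 u : (0 <= (\1_A u)%:E :> \bar R)%E by rewrite lee_fin.
    rewrite (mint_dirichlet_kernel alpha 1 t0 mAE AE0).
    (* At simplex size [1] the homogeneity factor is [1]. *)
    rewrite ltr01 powR1 mulr1 mul1e LE; [|exact: emeasurable_funM|]; last first.
      by move=> u; rewrite mule_ge0 ?lee_fin ?beta_kernel_ge0.
    rewrite -ge0_integralZl//; [|exact: emeasurable_funM|]; last first.
      by move=> u _; rewrite mule_ge0 ?lee_fin ?beta_kernel_ge0.
    by apply: eq_integral => u _; rewrite -!EFinM; congr EFin; ring.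
  (* Tonelli again brings [u] outside; the inner integral over [v] is then [h u]. *)
  rewrite -(fubini_tonelli _ mAcfk Acfk0).
  rewrite [RHS]integral_mkcond; apply: eq_integral => u _.
  rewrite patchE /= indicE; case: ifPn => _.
    by apply: eq_integral => t _; rewrite mul1e.
  by rewrite integral0_eq// => t _; rewrite mul0e.
have intg : (\int[L]_t (g t)%:E = 1)%E.
  have := Du setT measurableT; rewrite preimage_setT probability_setT densE// => ->.
  by apply: eq_integral => t _; rewrite indicT mul1r.
(* Total mass [1] makes [g] integrable, which lets equal integrals over all measurable sets yield
   almost-everywhere equality. *)
have gint : L.-integrable setT (EFin \o g).
  apply/integrableP; split; first exact/measurable_EFinP.
  under eq_integral do rewrite /= ger0_norm//.
  by rewrite intg ltry.
have : ae_eq L setT (EFin \o g) h.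
  by apply: integral_ae_eq => // A _; exact: key.
move=> [M [mM M0 gh]]; exists M; split => //; last first.
  rewrite LE; [|by apply/measurable_EFinP; exact: mind|by move=> t; rewrite lee_fin].
  by rewrite integral_indic// setIT.
(* It remains to prove the identity at a positive [u] outside the null set, where [g u = h u]. *)
move=> u [u0]; apply: contra_notP => uM.
have ghu : (g u)%:E = h u.
  by apply: contra_notP uM => ghu; apply: gh => /= /(_ I).
(* Telescoping exposes the Dirichlet constant, which is the factor [cD] inside [h]. *)
rewrite kober1E// EFinM ghu (Gamma_telescope alpha0); last exact: cD_neq0.
rewrite EFinM -muleA; congr (_ * _)%E.
have m_fk : measurable_fun setT (fun t => (f t * beta_kernel alpha u t)%:E).
  apply/measurable_EFinP; apply: measurable_funM => //.
  exact: (measurable_fun_pair2 u (measurable_beta_kernel alpha)).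
have fk0 t : (0 <= (f t * beta_kernel alpha u t)%:E)%E.
  by rewrite lee_fin mulr_ge0 ?beta_kernel_ge0.
rewrite /h; under [RHS]eq_integral do rewrite EFinM.
by rewrite LE// ge0_integralZl.
Qed.
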